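(* Let $k$ be a field and let $A$ be a unital associative $k$-algebra. Every finitely cogenerated injective right $A$-module admits a hom-connection with respect to any differential graded algebra over $A$.
   Context: A differential graded algebra over $A$ is a non-negatively graded differential graded algebra $(\Omega(A),d)$ over $k$ (with $d$ of degree $+1$, $d^2=0$, satisfying the graded Leibniz rule) such that $\Omega^0(A)=A$. A (right) hom-connection on a right $A$-module $M$ with respect to $(\Omega(A),d)$ is a $k$-linear map $\nabla:\mathrm{Hom}_A(\Omega^1(A),M)\to M$, where $\mathrm{Hom}_A$ denotes right $A$-module maps, such that $\nabla(fa)=\nabla(f)a+f(da)$ for all $f\in\mathrm{Hom}_A(\Omega^1(A),M)$ and $a\in A$. Here $\mathrm{Hom}_A(\Omega^1(A),M)$ is a right $A$-module by $(fa)(\omega)=f(a\omega)$. *)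

(* Defs.v *)
From HB Require Import structures.
From mathcomp Require Import all_boot all_algebra.

Set Implicit Arguments.
Unset Strict Implicit.
Unset Printing Implicit Defensive.

Import GRing.Theory.
Local Open Scope ring_scope.

(* A right A-module is a left module over the converse ring A^c. *)
Notation rmodType A := (lmodType A^c).

Definition ract (A : pzRingType) (M : rmodType A) (m : M) (a : A) : M :=
  (a : A^c) *: m.

Lemma ractA (A : pzRingType) (M : rmodType A) (m : M) (a b : A) :
  ract (ract m a) b = ract m (a * b).
Proof. by rewrite /ract scalerA. Qed.

(* The underlying k-vector space structure of a right module over a
   k-algebra: k acts through k -> A, c |-> c *: 1. *)
Definition kscale (k : fieldType) (A : algType k) (M : rmodType A)
  (c : k) (m : M) : M := ract m (c *: 1).

Definition injective_module (A : pzRingType) (M : rmodType A) : Prop :=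
  forall (X Y : rmodType A) (i : {linear X -> Y}) (f : {linear X -> M}),
    injective i -> exists g : {linear Y -> M}, forall x, g (i x) = f x.

(* Every family of submodules with zero intersection has a finite subfamily
   with zero intersection. *)
Definition finitely_cogenerated (A : pzRingType) (M : rmodType A) : Prop :=
  forall (I : Type) (U : I -> {pred M}),
    (forall i, submod_closed (U i)) ->
    (forall x, (forall i, x \in U i) -> x = 0) ->
    exists (n : nat) (t : 'I_n -> I),
      forall x, (forall j, x \in U (t j)) -> x = 0.

Definition graded_part (k : fieldType) (A : algType k) (P : nat -> lmodType k)
  (n : nat) : lmodType k := if n is n'.+1 then P n' else A.

(* Differential graded algebras over A. The components of positive degree are
   given by dga_pos, and the component of degree 0 is A itself. The product is
   indexed by proofs of m + n = p, so that no transport along equalities between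
   degrees is needed to state its associativity. *)
Record dga (k : fieldType) (A : algType k) := Dga {
  dga_pos : nat -> lmodType k;
  dga_part := graded_part A dga_pos;
  dga_mul : forall m n p : nat, (m + n = p)%N ->
    {bilinear dga_part m -> dga_part n -> dga_part p};
  dga_mul0 : forall (e : (0 + 0 = 0)%N) (a b : A), dga_mul e a b = a * b :> A;
  dga_mul1l : forall n (e : (0 + n = n)%N) (x : dga_part n),
    dga_mul e (1 : A) x = x;
  dga_mul1r : forall n (e : (n + 0 = n)%N) (x : dga_part n),
    dga_mul e x (1 : A) = x;
  dga_mulA : forall m n p mn np q
    (e1 : (m + n = mn)%N) (e2 : (mn + p = q)%N)
    (e3 : (n + p = np)%N) (e4 : (m + np = q)%N)
    (x : dga_part m) (y : dga_part n) (z : dga_part p),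
    dga_mul e2 (dga_mul e1 x y) z = dga_mul e4 x (dga_mul e3 y z);
  dga_d : forall n, {linear dga_part n -> dga_part n.+1};
  dga_dd : forall n (x : dga_part n), dga_d n.+1 (dga_d n x) = 0;
  dga_leibniz : forall m n p (e : (m + n = p)%N)
    (e1 : (m.+1 + n = p.+1)%N) (e2 : (m + n.+1 = p.+1)%N)
    (x : dga_part m) (y : dga_part n),
    dga_d p (dga_mul e x y) =
      dga_mul e1 (dga_d m x) y + (-1) ^+ m *: dga_mul e2 x (dga_d n y)
}.

Definition one_forms (k : fieldType) (A : algType k) (D : dga A) : Type :=
  dga_part D 1.

Section OneForms.
Variables (k : fieldType) (A : algType k) (D : dga A).

HB.instance Definition _ := GRing.Zmodule.on (one_forms D).

Definition form_lact (a : A) (w : one_forms D) : one_forms D :=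
  dga_mul D (erefl : (0 + 1 = 1)%N) a w.

Definition form_ract (w : one_forms D) (a : A) : one_forms D :=
  dga_mul D (erefl : (1 + 0 = 1)%N) w a.

Definition form_d (a : A) : one_forms D := dga_d D 0 a.

Let one_forms_scale (a : A^c) (w : one_forms D) := form_ract w a.

Let one_forms_scaleA (a b : A^c) (w : one_forms D) :
  one_forms_scale a (one_forms_scale b w) = one_forms_scale (a * b) w.
Proof.
rewrite /one_forms_scale /form_ract.
rewrite (dga_mulA _ _ (erefl : (0 + 0 = 0)%N) (erefl : (1 + 0 = 1)%N)).
by rewrite dga_mul0.
Qed.

Let one_forms_scale1 : left_id 1 one_forms_scale.
Proof. by move=> w; apply: dga_mul1r. Qed.

Let one_forms_scaleDr : right_distributive one_forms_scale +%R.
Proof. by move=> a v w; apply: linearDl. Qed.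

Let one_forms_scaleDl w : {morph one_forms_scale^~ w : a b / a + b}.
Proof. by move=> a b; apply: linearDr. Qed.

(* Only the right A-module structure is canonical on one_forms. *)
HB.instance Definition _ :=
  GRing.Zmodule_isLmodule.Build A^c (one_forms D)
    one_forms_scaleA one_forms_scale1 one_forms_scaleDr one_forms_scaleDl.

Lemma one_formsE (w : one_forms D) (a : A) : ract w a = form_ract w a.
Proof. by []. Qed.

End OneForms.

(* Hom_A(Omega^1(A), M) is {linear one_forms D -> M}, with right A-action
   (f a)(w) = f (a w). *)
Section Hom.
Variables (k : fieldType) (A : algType k) (D : dga A) (M : rmodType A).
Implicit Types (f : {linear one_forms D -> M}) (a : A).

Definition hom_ract f a (w : one_forms D) : M := f (form_lact a w).

Fact hom_ract_linear f a : linear (hom_ract f a).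
Proof.
move=> b v w; rewrite /hom_ract -linearP; congr (f _).
rewrite /form_lact linearDr; congr (_ + _).
symmetry; exact: dga_mulA.
Qed.

HB.instance Definition _ f a :=
  GRing.isLinear.Build A^c (one_forms D) M _ (hom_ract f a)
    (hom_ract_linear f a).

Definition hom_kscale (c : k) f (w : one_forms D) : M := kscale c (f w).

Fact kscale_one_forms c (w : one_forms D) :
  kscale c w = (c *: (w : dga_part D 1) : dga_part D 1).
Proof. by rewrite /kscale one_formsE /form_ract linearZr_LR /= dga_mul1r. Qed.

Fact hom_kscaleE c f w : hom_kscale c f w = hom_ract f (c *: 1) w.
Proof.
rewrite /hom_kscale /hom_ract /form_lact linearZl_LR /= dga_mul1l.
by rewrite -kscale_one_forms /kscale /ract linearZ.
Qed.

Fact hom_kscale_linear c f : linear (hom_kscale c f).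
Proof. by move=> b v w; rewrite !hom_kscaleE linearP. Qed.

HB.instance Definition _ c f :=
  GRing.isLinear.Build A^c (one_forms D) M _ (hom_kscale c f)
    (hom_kscale_linear c f).

Definition hom_connection (nabla : {linear one_forms D -> M} -> M) : Prop :=
  [/\ forall f g : {linear one_forms D -> M}, nabla (f \+ g) = nabla f + nabla g,
      forall c f, nabla (hom_kscale c f) = kscale c (nabla f) &
      forall f a, nabla (hom_ract f a) = ract (nabla f) a + f (form_d D a)].

End Hom.

(* Main.v *)
Require Import Defs.
From HB Require Import structures.
From mathcomp Require Import all_boot all_algebra.
From mathcomp Require Import boolp functions.

(**
The mechanism: injectivity of M makes it a direct summand of a module on
which a hom-connection is visible.

Let C = Hom_Z(A, M) be the module of additive maps A -> M, with right action
(phi b)(a) = phi (b a).  The map m |-> (a |-> m a) embeds M in C (evaluate at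
1), so that injectivity of M yields a right A-linear retraction r : C -> M
([injective_coinduced_retract]).  For f in Hom_A(Omega^1, M), the composite
f d : a |-> f (da) is additive, hence an element of C.  The Leibniz rule
d(ba) = (db) a + b (da) gives, by right linearity of f,

   f (d (b a)) = f (db) a + (f b) (da),

that is (f d) b = u (f (db)) + (f b) d in C, where u : M -> C is the embedding
([ext_form_d_ract]).  Applying r, which satisfies r u = id, turns this into the
hom-connection identity for nabla f = - r (f d); the sign is there because the
identity reads r ((f b) d) = r (f d) b - f (db).  Compatibility with k holds
because d is k-linear.
*)

Set Implicit Arguments.
Unset Strict Implicit.
Unset Printing Implicit Defensive.

Import GRing.Theory.
Local Open Scope ring_scope.

(** * Coinduced modules *)

(** A subtype, so that equality is equality of the underlying functions.  All
    additive maps are taken, rather than the k-linear ones, so that only the ring structure of A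
    is involved. *)
Definition coinduced (A : pzRingType) (M : zmodType) : Type :=
  {phi : A -> M | `[< zmod_morphism phi >]}.

Section Coinduced.
Variables (A : pzRingType) (M : zmodType).
Implicit Types (phi : coinduced A M) (a b : A).

HB.instance Definition _ := SubChoice.on (coinduced A M).

Fact coinduced_closed :
  zmod_closed [pred phi : A -> M | `[< zmod_morphism phi >]].
Proof.
split=> [|phi psi /asboolP phiB /asboolP psiB]; apply/asboolP => a b /=.
  by rewrite subr0.
by rewrite !fctE phiB psiB !opprB addrACA [RHS]addrACA [- psi a + _]addrC.
Qed.

HB.instance Definition _ :=
  GRing.SubChoice_isSubZmodule.Build (A -> M) _ (coinduced A M)
    coinduced_closed.

Lemma coinduced_morph phi : zmod_morphism (val phi).
Proof. exact/asboolP/(valP phi). Qed.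

Lemma coinduced_morphD phi : {morph val phi : a b / a + b}.
Proof.
by move=> a b; rewrite -{2}[a](addrK b) (coinduced_morph phi (a + b) b) subrK.
Qed.

Definition Coinduced (h : A -> M) (hB : zmod_morphism h) : coinduced A M :=
  Sub h (introT (asboolP _) hB).

Lemma coinducedP phi psi : (forall a, val phi a = val psi a) -> phi = psi.
Proof. by move=> eq_phi; apply/val_inj/funext. Qed.

Fact coinduced_scale_morph (b : A^c) phi :
  zmod_morphism (fun a => val phi ((b : A) * a)).
Proof. by move=> x y; rewrite mulrBr coinduced_morph. Qed.

Definition coinduced_scale (b : A^c) phi : coinduced A M :=
  Coinduced (coinduced_scale_morph b phi).

Let coinduced_scaleA (b c : A^c) phi :
  coinduced_scale b (coinduced_scale c phi) = coinduced_scale (b * c) phi.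
Proof. by apply: coinducedP => a; congr (val phi _); exact: mulrA. Qed.

Let coinduced_scale1 : left_id 1 coinduced_scale.
Proof. by move=> phi; apply: coinducedP => a; congr (val phi _); exact: mul1r. Qed.

Let coinduced_scaleDr : right_distributive coinduced_scale +%R.
Proof. by move=> b phi psi; apply: coinducedP. Qed.

Let coinduced_scaleDl phi : {morph coinduced_scale^~ phi : b c / b + c}.
Proof.
move=> b c; apply: coinducedP => a.
by rewrite /= mulrDl; apply: coinduced_morphD.
Qed.

HB.instance Definition _ :=
  GRing.Zmodule_isLmodule.Build A^c (coinduced A M)
    coinduced_scaleA coinduced_scale1 coinduced_scaleDr coinduced_scaleDl.

Lemma coinduced_ractE phi b a : val (ract phi b) a = val phi (b * a).
Proof. by []. Qed.

End Coinduced.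

(** * Injective modules are retracts of coinduced modules *)

Section Unit.
Variables (A : pzRingType) (M : rmodType A).

Fact ract_zmod_morphism (m : M) : zmod_morphism (ract m : A -> M).
Proof. by move=> a b; apply: scalerBl. Qed.

Definition coinduced_unit (m : M) : coinduced A M :=
  Coinduced (ract_zmod_morphism m).

Fact coinduced_unit_linear : linear coinduced_unit.
Proof.
move=> b m n; apply: coinducedP => a.
by rewrite /= /ract scalerDr scalerA.
Qed.

HB.instance Definition _ :=
  GRing.isLinear.Build A^c M (coinduced A M) _ coinduced_unit
    coinduced_unit_linear.

Lemma coinduced_unit_inj : injective coinduced_unit.
Proof.
by move=> m n /(congr1 (fun phi => val phi 1)); rewrite /= /ract !scale1r.
Qed.

(** Extend the identity of M along its embedding in the coinduced module. *)
Lemma injective_coinduced_retract :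
  injective_module M ->
  exists r : {linear coinduced A M -> M},
    forall m, r (coinduced_unit m) = m.
Proof. by move/(_ _ _ coinduced_unit idfun coinduced_unit_inj). Qed.

End Unit.

(** * The Leibniz rule in the coinduced module *)

Section FormD.
Variables (k : fieldType) (A : algType k) (M : rmodType A) (D : dga A).
Implicit Types (f g : {linear one_forms D -> M}).

Lemma form_d_mul (a b : A) :
  form_d D (a * b) = form_ract (form_d D a) b + form_lact a (form_d D b).
Proof.
rewrite /form_d -(dga_mul0 D (erefl : (0 + 0 = 0)%N)).
by rewrite (dga_leibniz _ (erefl : (1 + 0 = 1)%N) (erefl : (0 + 1 = 1)%N)) scale1r.
Qed.

Fact ext_form_d_morph f : zmod_morphism (fun a : A => f (form_d D a)).
Proof. by move=> a b; rewrite /form_d raddfB; apply: raddfB. Qed.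

Definition ext_form_d f : coinduced A M := Coinduced (ext_form_d_morph f).

Lemma ext_form_dD f g : ext_form_d (f \+ g) = ext_form_d f + ext_form_d g.
Proof. exact: coinducedP. Qed.

(** The scalar c moves through d by k-linearity, then to the right of da, where
    f releases it. *)
Lemma ext_form_d_kscale (c : k) f :
  ext_form_d (hom_kscale c f) = kscale c (ext_form_d f).
Proof.
apply: coinducedP => a; rewrite coinduced_ractE /= -scalerAl mul1r.
rewrite /hom_kscale /form_d linearZ /= -kscale_one_forms.
by rewrite /kscale /ract linearZ.
Qed.

(** The Leibniz rule for d(ba): right linearity of f turns (db) a into the value
    at a of the embedded element f(db). *)
Lemma ext_form_d_ract f (b : A) :
  ext_form_d (hom_ract f b)
    = ract (ext_form_d f) b - coinduced_unit (f (form_d D b)).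
Proof.
apply/eqP; rewrite eq_sym subr_eq addrC; apply/eqP/coinducedP => a.
rewrite coinduced_ractE /= form_d_mul raddfD /=; congr (_ + _).
by rewrite -one_formsE /ract linearZ.
Qed.

End FormD.

Theorem proposition2p4 (k : fieldType) (A : algType k) (M : rmodType A) :
  finitely_cogenerated M -> injective_module M ->
  forall D : dga A,
    exists nabla : {linear one_forms D -> M} -> M, hom_connection nabla.
Proof.
move=> _ /injective_coinduced_retract[r unitK] D.
exists (fun f => - r (ext_form_d f)); split=> [f g|c f|f a].
- by rewrite ext_form_dD linearD opprD.
- by rewrite ext_form_d_kscale /kscale /ract linearZ scalerN.
- by rewrite ext_form_d_ract linearB unitK opprB addrC /ract linearZ scalerN.
Qed.
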